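(* Let $X$ be a set and let $\{f_k\}_{k\in\mathbb{N}}$ be a sequence of real valued functions defined on $X$. Then the following statements are equivalent. (i) $\{f_k\}_{k\in\mathbb{N}}$ is a pointwise rough statistically convergent sequence on $X$. (ii) $\{f_k\}_{k\in\mathbb{N}}$ is a rough statistically Cauchy sequence on $X$. (iii) There exists a pointwise rough statistically convergent sequence $\{g_k\}_{k\in\mathbb{N}}$ of real valued functions on $X$ such that $f_k(x)=g_k(x)$ a.a.k. for every $x\in X$.
   Context: For a statement $P(k)$ about $k\in\mathbb{N}$, ''$P(k)$ a.a.k.'' (for almost all $k$) means that the set of exceptional indices has natural density zero: $\lim_{n\to\infty}\frac1n|\{k\le n : P(k)\text{ fails}\}|=0$, where $|\cdot|$ of a set denotes its number of elements. A sequence $\{h_k\}_{k\in\mathbb{N}}$ of real valued functions on a set $X$ is pointwise rough statistically convergent on $X$ if there is a function $h:X\to\mathbb{R}$ such that for every $\varepsilon>0$ there exists a real number $r>0$ with $$\lim_{n\to\infty}\frac1n\bigl|\{k\le n:|h_k(x)-h(x)|\ge r+\varepsilon\}\bigr|=0\quad\text{for every }x\in X,$$ i.e. $|h_k(x)-h(x)|<r+\varepsilon$ a.a.k. for every $x\in X$. A sequence $\{h_k\}_{k\in\mathbb{N}}$ of real valued functions on $X$ is rough statistically Cauchy on $X$ if there is a real number $r>0$ such that for every $\varepsilon>0$ and every $x\in X$ there exists a natural number $N=N(\varepsilon,x)$ with $|h_k(x)-h_N(x)|<r+\varepsilon$ a.a.k., i.e. $$\lim_{n\to\infty}\frac1n\bigl|\{k\le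 n:|h_k(x)-h_N(x)|\ge r+\varepsilon\}\bigr|=0.$$ *)

(* Defs.v *)
From HB Require Import structures.
From mathcomp Require Import all_boot all_order all_algebra.
From mathcomp Require Import all_classical all_reals all_analysis.

Set Implicit Arguments.
Unset Strict Implicit.
Unset Printing Implicit Defensive.

Import Order.TTheory GRing.Theory Num.Theory.
Import numFieldNormedType.Exports.

Local Open Scope classical_set_scope.
Local Open Scope ring_scope.

(* Indices start at 0, so [k <= n] ranges over the n + 1 elements of 'I_n.+1
   while the count is still divided by n: the limit is the same, and the term
   n = 0, where n%:R^-1 = 0, is irrelevant to it. *)
Definition almost_all_k (R : realType) (P : nat -> Prop) : Prop :=
  (n%:R^-1 * #|[set k : 'I_n.+1 | `[< ~ P k >]]%SET|%:R : R) @[n --> \oo]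
    --> (0 : R).

(* Here r may depend on eps but not on x. *)
Definition rough_stat_cvg (R : realType) (X : Type) (h_ : nat -> X -> R) :
    Prop :=
  exists h : X -> R, forall eps : R, 0 < eps ->
    exists r : R, 0 < r /\
      forall x : X, almost_all_k R (fun k => `|h_ k x - h x| < r + eps).

Definition rough_stat_cauchy (R : realType) (X : Type) (h_ : nat -> X -> R) :
    Prop :=
  exists r : R, 0 < r /\
    forall (eps : R) (x : X), 0 < eps ->
      exists N : nat, almost_all_k R (fun k => `|h_ k x - h_ N x| < r + eps).

(* Main.v *)
Require Import Defs.
From mathcomp Require Import all_boot all_order all_algebra.
From mathcomp Require Import all_classical all_reals all_analysis.

(** The predicates that hold for almost all k form a proper filter on the
    natural numbers: they are stable under weakening ([almost_all_kS]) and
    conjunction ([almost_all_kI]), and each of them holds somewhere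
    ([almost_all_k_ex]), because the set of all indices has density one.

    Moreover, since the roughness degree may be enlarged at will, rough
    statistical convergence to [h] amounts to the existence of one constant
    [c], uniform in [x], such that [|h_k(x) - h(x)| < c] for almost all [k]
    ([rough_stat_cvgP]), and the Cauchy condition unfolds likewise
    ([rough_stat_cauchyP]).  The equivalence is then immediate: if [h] is a
    limit with constant [c], some index [N] satisfies [|h_N(x) - h(x)| < c], so
    the triangle inequality gives the Cauchy condition with constant [2c];
    conversely, choosing for each [x] a Cauchy index [N(x)], the function
    [x |-> h_{N(x)}(x)] is a rough limit.  Changing the sequence outside an
    almost full set of indices, at each point, preserves rough limits by the
    filter property. *)

Set Implicit Arguments.
Unset Strict Implicit.
Unset Printing Implicit Defensive.

Import Order.TTheory GRing.Theory Num.Theory.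
Import numFieldNormedType.Exports.

Local Open Scope classical_set_scope.
Local Open Scope ring_scope.

(** * The filter of almost full sets of indices *)

Section AlmostAll.
Context {R : realType}.
Implicit Types P Q S : nat -> Prop.

(** A single counting argument gives both stability under weakening ([P = Q])
    and under conjunction: the exceptions to [S] are covered by those to [P]
    and those to [Q], so their frequency is squeezed between zero and a sum of
    two null sequences. *)
Lemma almost_all_kS2 P Q S : (forall k, P k -> Q k -> S k) ->
  almost_all_k R P -> almost_all_k R Q -> almost_all_k R S.
Proof.
move=> PQS Pae Qae; rewrite /almost_all_k.
have := cvgD Pae Qae; rewrite addr0 => PQ0.
apply: squeeze_cvgr (cvg_cst 0) (PQ0 _).
apply: nearW => n; rewrite !fctE /= mulr_ge0 ?invr_ge0 ?ler0n //=.
rewrite -mulrDr ler_wpM2l ?invr_ge0 ?ler0n // -natrD ler_nat.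
apply: leq_trans (leq_card_setU _ _).
apply/subset_leq_card/fintype.subsetP => k.
rewrite !inE => nSk; apply/orP.
have [Pk|nPk] := pselect (P k); last by left; apply/asboolP.
by right; apply/asboolP => Qk; apply: nSk; exact: PQS.
Qed.

Lemma almost_all_kS P S : (forall k, P k -> S k) ->
  almost_all_k R P -> almost_all_k R S.
Proof. by move=> PS Pae; apply: (almost_all_kS2 _ Pae Pae) => k /PS. Qed.

Lemma almost_all_kI P Q : almost_all_k R P -> almost_all_k R Q ->
  almost_all_k R (fun k => P k /\ Q k).
Proof. exact: almost_all_kS2. Qed.

Lemma almost_all_kT P : (forall k, P k) -> almost_all_k R P.
Proof.
move=> PT; rewrite /almost_all_k.
rewrite (_ : (fun _ => _) = cst 0); first exact: cvg_cst.
apply/funext => n; rewrite (_ : [set _ | _]%SET = finset.set0) ?cards0 ?mulr0 //.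
by apply/setP => k; rewrite !inE; apply/asboolP; apply.
Qed.

(** If [P] failed everywhere, its exceptions would have frequency
    [(n + 1) / n >= 1], which does not tend to zero. *)
Lemma almost_all_k_ex P : almost_all_k R P -> exists k, P k.
Proof.
move=> Pae; apply: contrapT => /forallNP nP.
have [n _ /(_ n.+1 (leqnSn n))] := cvgr_lt _ Pae _ ltr01.
rewrite /= (_ : [set _ | _]%SET = [set: _]%SET); last first.
  by apply/setP => k; rewrite !inE; exact/asboolP.
rewrite cardsT card_ord mulrC ltr_pdivrMr ?ltr0n // mul1r ltr_nat.
by rewrite ltnNge leqnSn.
Qed.

End AlmostAll.

(** * Roughness as a uniform bound *)

Section Rough.
Context {R : realType} {X : Type}.
Implicit Types (f g : nat -> X -> R).

(** Taking [eps = 1] yields [c = r + 1]; conversely [r = c] serves every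
    [eps]. *)
Lemma rough_stat_cvgP f : rough_stat_cvg f <->
  exists (h : X -> R) (c : R), 0 < c /\
    forall x, almost_all_k R (fun k => `|f k x - h x| < c).
Proof.
split=> [[h /(_ 1 ltr01)[r [r0 hr]]]|[h [c [c0 hc]]]].
  by exists h, (r + 1); rewrite addr_gt0.
exists h => e e0; exists c; split=> // x.
by apply: almost_all_kS (hc x) => k /lt_trans; apply; rewrite ltrDl.
Qed.

Lemma rough_stat_cauchyP f : rough_stat_cauchy f <->
  exists c : R, 0 < c /\
    forall x, exists N, almost_all_k R (fun k => `|f k x - f N x| < c).
Proof.
split=> [[r [r0 hr]]|[c [c0 hc]]].
  by exists (r + 1); rewrite addr_gt0 //; split=> // x; exact: hr.
exists c; split=> // e x e0; have [N hN] := hc x; exists N.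
by apply: almost_all_kS hN => k /lt_trans; apply; rewrite ltrDl.
Qed.

Lemma rough_stat_cvg_cauchy f : rough_stat_cvg f <-> rough_stat_cauchy f.
Proof.
rewrite rough_stat_cvgP rough_stat_cauchyP.
split=> [[h [c [c0 hc]]]|[c [c0 /boolp.choice[N hN]]]].
  exists (c + c); rewrite addr_gt0 //; split=> // x.
  have [N hN] := almost_all_k_ex (hc x); exists N.
  apply: almost_all_kS (hc x) => k hk.
  by rewrite (le_lt_trans (ler_distD (h x) _ _)) // ltrD // distrC.
by exists (fun x => f (N x) x), c.
Qed.

Lemma eq_rough_stat_cvg f g :
  (forall x, almost_all_k R (fun k => f k x = g k x)) ->
  rough_stat_cvg g -> rough_stat_cvg f.
Proof.
move=> fg /rough_stat_cvgP[h [c [c0 hc]]]; apply/rough_stat_cvgP.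
exists h, c; split=> // x.
by apply: almost_all_kS (almost_all_kI (fg x) (hc x)) => k [->].
Qed.

End Rough.

Theorem theorem2p2 (R : realType) (X : Type) (f : nat -> X -> R) :
  (rough_stat_cvg f <-> rough_stat_cauchy f) /\
  (rough_stat_cvg f <->
    exists g : nat -> X -> R,
      rough_stat_cvg g /\
      forall x : X, almost_all_k R (fun k => f k x = g k x)).
Proof.
split; first exact: rough_stat_cvg_cauchy.
split=> [fcvg|[g [gcvg fg]]]; last exact: eq_rough_stat_cvg fg gcvg.
by exists f; split=> // x; exact: almost_all_kT.
Qed.
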